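(* Let $\phi\in H^1_\#(\Gamma_Y)^2$ be an arbitrary solution of $$\int_{\Gamma_Y}\partial_\Gamma\phi(y)\,\partial_\Gamma\psi(y)\,ds(y)=-\int_{\Gamma_Y}\mathbf t(y)\,\partial_\Gamma\psi(y)\,ds(y)\qquad\forall\psi\in H^1_\#(\Gamma_Y).$$ Then the $2\times 2$ matrix $$\mathbf A_{\rm hom}=\frac1{|\Gamma_Y|}\int_{\Gamma_Y}\big(\mathbf t(y)+\partial_\Gamma\phi(y)\big)\big(\mathbf t(y)+\partial_\Gamma\phi(y)\big)^T\,ds(y)$$ is symmetric and positive definite.
   Context: Let $e_1=(1,0)$, $e_2=(0,1)$. The unit mesh $\Gamma_Y\subset[0,1]^2$ is a one-dimensional set described by a connected oriented (finite) graph with vertex set $\mathcal V$ and edge set $\mathcal E$; each edge admits a bijective $W^{1,\infty}$ arc length parametrization $\gamma$ from an open interval, directed according to the orientation; $\mathbf t(y)=\gamma'(\gamma^{-1}(y))$ is the unit tangent. It is assumed that there are $y_1,y_2\in\Gamma_Y$ with $y_1+e_1,y_2+e_2\in\Gamma_Y$. The periodic graph $\Gamma_{Y,\#}$ is obtained from $\Gamma_Y$ by identifying opposite points, i.e. $y$ with $y+e_i$ whenever both lie in $\Gamma_Y\cap\partial[0,1]^2$ (such points are vertices), and by identifying all corner points of $[0,1]^2$ that belong to $\Gamma_Y$. On an oriented edge with arc length parametrization $\gamma$, $\partial_\Gamma u(x)=\frac{d}{ds}(u\circ\gamma)(s)$ with $s=\gamma^{-1}(x)$ (componentwise for vector functions).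 Integrals over graphs are sums over edges of curve integrals of the first kind; $|\Gamma_Y|=\int_{\Gamma_Y}ds$. For a graph $\mathcal G$, $H^1(\mathcal G)=\{u\in L^2(\mathcal G):\partial_\Gamma u\in L^2(\mathcal G),\ u\text{ continuous on }\mathcal G\}$; $H^1_\#(\Gamma_Y)=H^1(\Gamma_{Y,\#})$, so its elements take equal values at identified points. *)

(* Defs.v *)
From HB Require Import structures.
From mathcomp Require Import all_boot all_order all_algebra.
From mathcomp Require Import all_classical all_reals all_analysis.
Set Implicit Arguments.
Unset Strict Implicit.
Unset Printing Implicit Defensive.
Import Order.TTheory GRing.Theory Num.Theory.
Import numFieldNormedType.Exports.
Local Open Scope classical_set_scope.
Local Open Scope ring_scope.

(** * Sobolev functions on a bounded open interval *)

Section Interval.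
Variable R : realType.
Implicit Types (a b : R) (u g p : R -> R).
Let mu := @lebesgue_measure R.

(* C^1 functions on the line with compact support in ]a, b[. *)
Definition test_function a b p : Prop :=
  [/\ forall x, derivable p x 1, continuous (derive1 p) &
      exists c d, [/\ a < c, d < b & forall x, x \notin `[c, d] -> p x = 0]].

Definition is_weak_deriv a b u g : Prop :=
  [/\ locally_integrable `]a, b[ u, locally_integrable `]a, b[ g &
      forall p, test_function a b p ->
        \int[mu]_(s in `]a, b[) (u s * derive1 p s) =
        - \int[mu]_(s in `]a, b[) (g s * p s)].

Definition weakly_derivable a b u : Prop := exists g, is_weak_deriv a b u g.

(* A representative of the weak derivative, which is unique up to equality
   almost everywhere on ]a, b[. *)
Definition weak_deriv a b u : R -> R :=
  xget (fun=> 0) [set g | is_weak_deriv a b u g].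

Definition L2 a b u : Prop :=
  measurable_fun `]a, b[ u /\
  mu.-integrable `]a, b[ (fun s => (u s ^+ 2)%:E).

End Interval.

(** * Oriented finite graphs drawn in the plane *)

Record planar_graph (R : realType) := PlanarGraph {
  vertex : finType ;
  edge : finType ;
  pos : vertex -> 'cV[R]_2 ;
  src : edge -> vertex ;
  tgt : edge -> vertex ;
  lo : edge -> R ;
  hi : edge -> R ;
  curve : edge -> R -> 'cV[R]_2 }.

Section Graph.
Variables (R : realType) (G : planar_graph R).
Implicit Types (e : edge G) (u : 'cV[R]_2 -> R) (y z : 'cV[R]_2).
Let mu := @lebesgue_measure R.

Definition edge_dom e : set R := `]lo e, hi e[.

Definition edge_set e : set 'cV[R]_2 := curve e @` edge_dom e.

Definition Gamma : set 'cV[R]_2 :=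
  range (@pos R G) `|` \bigcup_e edge_set e.

Definition edge_rel : rel (vertex G) := [rel v w | [exists e : edge G,
  ((src e == v) && (tgt e == w)) || ((src e == w) && (tgt e == v))]].

Definition velocity e (s : R) : 'cV[R]_2 :=
  \col_i weak_deriv (lo e) (hi e) (fun r => curve e r i 0) s.

(* [curve e] restricted to [edge_dom e] is the arc length parametrization; its
   values at [lo e] and [hi e] are its continuous extension to the end points.
   A bounded curve whose weak derivative has Euclidean norm 1 a.e. is in
   W^{1,oo}. An edge may be a loop. *)
Record edge_wf e : Prop := {
  lo_lt_hi : lo e < hi e ;
  curve_continuous : {within `[lo e, hi e], continuous (curve e)} ;
  curve_src : curve e (lo e) = pos (src e) ;
  curve_tgt : curve e (hi e) = pos (tgt e) ;
  curve_inj : {in `]lo e, hi e[ &, injective (curve e)} ;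
  curve_derivable : forall i : 'I_2,
    weakly_derivable (lo e) (hi e) (fun s => curve e s i 0) ;
  curve_unit_speed : {ae mu, forall s, edge_dom e s ->
    \sum_i velocity e s i 0 ^+ 2 = 1} }.

(* The last three fields say that [Gamma] is the disjoint union of the
   vertices and of the open edges, so that a point of an edge determines the
   edge and its parameter. *)
Record graph_wf : Prop := {
  graph_edges : forall e, edge_wf e ;
  graph_connected : forall v w : vertex G, connect edge_rel v w ;
  pos_inj : injective (@pos R G) ;
  edges_disjoint : trivIset setT edge_set ;
  vertices_off_edges : forall (v : vertex G) e, ~ edge_set e (pos v) }.

(** * Calculus on a graph *)

(* The function on the edges equal to F e (s) at the point curve e s. *)
Definition on_edges (T : zmodType) (F : edge G -> R -> T) y : T :=
  xget 0 [set z | exists e s, [/\ edge_dom e s, curve e s = y & F e s = z]].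

Definition tangent : 'cV[R]_2 -> 'cV[R]_2 := on_edges velocity.

Definition dGamma u : 'cV[R]_2 -> R :=
  on_edges (fun e => weak_deriv (lo e) (hi e) (u \o curve e)).

Definition dGammav (phi : 'cV[R]_2 -> 'cV[R]_2) y : 'cV[R]_2 :=
  \col_i dGamma (fun z => phi z i 0) y.

(* Curve integral of the first kind; the speed of the curves is 1. *)
Definition intGamma u : R :=
  \sum_(e : edge G) \int[mu]_(s in edge_dom e) u (curve e s).

Definition intGamma_mx m n (F : 'cV[R]_2 -> 'M[R]_(m, n)) : 'M[R]_(m, n) :=
  \matrix_(i, j) intGamma (fun y => F y i j).

Definition total_length : R := intGamma (fun=> 1).

Definition L2_graph u : Prop :=
  forall e, L2 (lo e) (hi e) (u \o curve e).

Definition H1_graph u : Prop :=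
  [/\ L2_graph u,
      forall e, weakly_derivable (lo e) (hi e) (u \o curve e),
      L2_graph (dGamma u) &
      {within Gamma, continuous u}].

(** * Unit meshes and periodic functions *)

Definition unit_vec (i : 'I_2) : 'cV[R]_2 := delta_mx i 0.

Definition unit_square : set 'cV[R]_2 :=
  [set y | forall i, 0 <= y i 0 <= 1].

Definition corner y : Prop := forall i, y i 0 = 0 \/ y i 0 = 1.

(* When y and y + unit_vec i are both in the unit square, both are on its
   boundary. *)
Definition opposite y z : Prop :=
  [/\ Gamma y, Gamma z & exists i, z = y + unit_vec i].

Definition identified y z : Prop :=
  opposite y z \/ [/\ Gamma y, Gamma z, corner y & corner z].

Record unit_mesh : Prop := {
  mesh_graph : graph_wf ;
  mesh_square : Gamma `<=` unit_square ;
  mesh_crossing : forall i, exists y, Gamma y /\ Gamma (y + unit_vec i) ;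
  mesh_opposite : forall y z, opposite y z ->
    range (@pos R G) y /\ range (@pos R G) z }.

(* H^1 of the quotient of the graph by [identified]: a function on the
   quotient is continuous iff the function it induces on [Gamma] is. *)
Definition H1_graph_per u : Prop :=
  H1_graph u /\ forall y z, identified y z -> u y = u z.

(** * The cell problem and the homogenized matrix *)

Definition cell_solution (phi : 'cV[R]_2 -> 'cV[R]_2) : Prop :=
  (forall i, H1_graph_per (fun y => phi y i 0)) /\
  forall psi, H1_graph_per psi ->
    intGamma_mx (fun y => dGamma psi y *: dGammav phi y) =
    - intGamma_mx (fun y => dGamma psi y *: tangent y).

Definition A_hom (phi : 'cV[R]_2 -> 'cV[R]_2) : 'M[R]_2 :=
  total_length^-1 *: intGamma_mx (fun y =>
    (tangent y + dGammav phi y) *m (tangent y + dGammav phi y)^T).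

End Graph.

Definition symmetric_mx (R : realType) n (A : 'M[R]_n) : Prop := A^T = A.

Definition posdef_mx (R : realType) n (A : 'M[R]_n) : Prop :=
  forall x : 'cV[R]_n, x != 0 -> 0 < (x^T *m A *m x) 0 0.

(* Main.v *)
(* For a vector x, the quadratic form x^T A x is |Gamma|^-1 times the integral
   of the square of x . (t + d phi), which is the derivative along the graph of
   w(y) = x . (y + phi y). If it vanishes, then w has zero weak derivative on
   every edge, hence is constant on every closed edge by the du Bois-Reymond
   lemma, hence is constant on the vertices by connectedness. As phi is
   periodic, w (y + e_i) - w y = x_i, so crossing the cell gives x = 0. *)
Require Import Defs.
From mathcomp Require Import all_boot all_order all_algebra.
From mathcomp Require Import all_classical all_reals all_analysis.
From mathcomp Require Import measurable_realfun ring lra.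
Set Implicit Arguments.
Unset Strict Implicit.
Unset Printing Implicit Defensive.
Import Order.TTheory GRing.Theory Num.Theory.
Import numFieldNormedType.Exports.
Local Open Scope classical_set_scope.
Local Open Scope ring_scope.

(** * Weak derivatives and square integrable functions on an interval *)

Section IntervalCalculus.
Variable R : realType.
Implicit Types (a b c d s t x e k m : R) (u v f g h p : R -> R).
Local Notation mu := (@lebesgue_measure R).

(** A C^1 function that vanishes on a half-line. Combinations of its translates supply test
    functions whose derivatives are explicit and piecewise linear. *)
Definition sqpos x : R := Num.max 0 x ^+ 2.

Lemma is_derive_sqpos x : is_derive x 1 sqpos (2 * Num.max 0 x).
Proof.
(* First-order Taylor expansion with remainder at most [k ^+ 2], by cases on the signs of [x] and
   [k + x]. Division by [k] leaves an error of at most [|k|] in the difference quotient. *)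
have taylor k : `|sqpos (k + x) - sqpos x - 2 * Num.max 0 x * k| <= k ^+ 2.
  rewrite /sqpos ler_norml !maxEle.
  by case: (leP 0 (k + x)) => ?; case: (leP 0 x) => ?; nra.
have cv : (fun k => k^-1 *: (sqpos (k *: 1 + x) - sqpos x)) @ 0^'
    --> 2 * Num.max 0 x.
  apply/cvgrPdist_le => /= e e0; near=> k.
  have k0 : k != 0 by near: k; exact: nbhs_dnbhs_neq.
  have ke : `|k| <= e.
    near: k; apply: nbhs_dnbhs; apply: filterS (nbhsx_ballx 0 e e0) => y.
    by rewrite /ball /= sub0r normrN => /ltW.
  apply: le_trans ke.
  rewrite distrC /GRing.scale /= mulr1.
  have -> : k^-1 * (sqpos (k + x) - sqpos x) - 2 * Num.max 0 x =
      k^-1 * (sqpos (k + x) - sqpos x - 2 * Num.max 0 x * k) by field.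
  rewrite normrM normfV ler_pdivrMl ?normr_gt0//.
  by rewrite -expr2 real_normK ?num_real.
split; first by apply/cvg_ex; exists (2 * Num.max 0 x).
exact: cvg_lim cv.
Unshelve. all: by end_near. Qed.

Lemma continuous_maxr0 : continuous (Num.max 0 : R -> R).
Proof. by move=> x; apply: continuous_max; [exact: cst_continuous|]. Qed.

(* The second difference of sqpos with step e: a C^1 step at s of width 2 e and
   height 2 e ^+ 2. *)
Definition smooth_step e s x : R :=
  sqpos (x - s + e) - 2 * sqpos (x - s) + sqpos (x - s - e).

(** For positive [e] this is the hat function max(0, e - |x - s|), which is half the derivative of
    [smooth_step]. *)
Definition tent e s x : R :=
  Num.max 0 (x - s + e) - 2 * Num.max 0 (x - s) + Num.max 0 (x - s - e).

Lemma is_derive_smooth_step e s x :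
  is_derive x 1 (smooth_step e s) (2 * tent e s x).
Proof.
have shift k : is_derive x 1 (fun y => sqpos (y + k)) (2 * Num.max 0 (x + k)).
  rewrite -[2 * Num.max 0 (x + k)]mulr1.
  exact: (@is_derive1_comp _ _ (shift k) _ _ _ (is_derive_sqpos _)
    (is_derive_shift _ _ _)).
have E : smooth_step e s = (fun y => sqpos (y + (e - s))) -
    2 *: (fun y => sqpos (y + (- s))) + (fun y => sqpos (y + (- s - e))).
  apply/funext => y; rewrite /smooth_step !fctE /GRing.scale /=.
  by congr (sqpos _ - _ + sqpos _); ring.
rewrite E; apply: is_derive_eq; rewrite /tent /GRing.scale /=.
by rewrite !addrA [x + e - s]addrAC; ring.
Qed.

Lemma tent_out e s x : 0 < e -> e <= `|x - s| -> tent e s x = 0.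
Proof.
rewrite /tent => e0; rewrite ler_normr => /orP[] h; rewrite !maxEle.
  by do 3 case: ifPn; rewrite -?ltNge => *; lra.
by do 3 case: ifPn; rewrite -?ltNge => *; lra.
Qed.

Lemma tent_gt0 e s x : `|x - s| < e -> 0 < tent e s x.
Proof.
rewrite /tent ltr_norml => /andP[h1 h2]; rewrite !maxEle.
by do 3 case: ifPn; rewrite -?ltNge => *; lra.
Qed.

Lemma tent_ge0 e s x : 0 < e -> 0 <= tent e s x.
Proof.
by move=> e0; case: (ltP `|x - s| e) => [/tent_gt0/ltW//|/tent_out->].
Qed.

Lemma smooth_step_left e s x : 0 < e -> x <= s - e -> smooth_step e s x = 0.
Proof.
move=> e0 h; rewrite /smooth_step /sqpos !max_l; first by ring.
all: lra.
Qed.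

Lemma smooth_step_right e s x :
  0 < e -> s + e <= x -> smooth_step e s x = 2 * e ^+ 2.
Proof.
move=> e0 h; rewrite /smooth_step /sqpos !max_r; first by ring.
all: lra.
Qed.

Lemma continuous_tent e s : continuous (tent e s).
Proof.
have h k : continuous (fun x : R => Num.max 0 (x + k)).
  move=> x; apply: (@continuous_comp _ _ _ (fun y => y + k) (Num.max 0)).
    by apply: continuousD => //; exact: cst_continuous.
  exact: continuous_maxr0.
move=> x; rewrite /tent.
have -> : (fun y => Num.max 0 (y - s + e) - 2 * Num.max 0 (y - s) +
    Num.max 0 (y - s - e)) = (fun y => Num.max 0 (y + (- s + e)) -
      2 * Num.max 0 (y - s) + Num.max 0 (y + (- s - e))).
  by apply/funext => y; rewrite !addrA.
apply: cvgD; last exact: h.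
apply: cvgB; first exact: h.
by apply: cvgM; [exact: cvg_cst|exact: h].
Qed.

(** The complement of the segment is open, so [p] vanishes near each of its points and its
    derivative is zero there. One segment thus serves for both [p] and its derivative. *)
Lemma test_function_support a b p : test_function a b p ->
  exists c d, [/\ a < c, d < b,
    forall x, x \notin `[c, d] -> p x = 0 &
    forall x, x \notin `[c, d] -> derive1 p x = 0].
Proof.
case=> dp cp [c [d [ac db p0]]]; exists c, d; split => // x xcd.
have : \forall y \near x, p y = 0.
  have : open (~` [set` `[c, d]] : set R).
    by apply: closed_openC; exact: itv_closed.
  rewrite openE => /(_ x) []; first by apply/negP.
  by move=> r r0 br; exists r => // y /br /negP/p0.
by move=> px; rewrite derive1E (@near_eq_derive _ _ _ p (cst 0))// derive_cst.
Qed.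

(** The product equals its restriction to the segment, where [u] is integrable by local
    integrability and [p] is bounded by compactness. Linearity of [Rintegral] relies on this
    integrability. *)
Lemma integrable_mul_compact_support a b c d u p :
  locally_integrable `]a, b[ u -> continuous p -> a < c -> d < b ->
  (forall x, x \notin `[c, d] -> p x = 0) ->
  mu.-integrable `]a, b[ (EFin \o (fun x => u x * p x)).
Proof.
move=> [mu_ _ iu] cp ac db p0.
have sub : `[c, d] `<=` `]a, b[.
  move=> x /=; rewrite !in_itv/= => /andP[cx xd].
  by rewrite (lt_le_trans ac)//= (le_lt_trans xd).
have iuK : mu.-integrable `[c, d] (EFin \o u).
  apply/integrableP; split; last exact: (iu _ sub (@segment_compact _ c d)).
  by apply/measurable_EFinP; apply: measurable_funS mu_.
have -> : EFin \o (fun x => u x * p x) =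
    ((EFin \o u) \* (EFin \o p))%E \_ `[c, d].
  apply/funext => x; rewrite patchE; case: ifPn => // xcd.
  by rewrite /= p0 ?mulr0//; apply: contra xcd => xcd; rewrite inE.
apply/integrable_restrict => //; rewrite setIidr//.
apply: integrableMl => //.
  by apply: measurable_funTS; exact: continuous_measurable_fun.
have /compact_bounded[M [_ Mp]] : compact (p @` `[c, d]).
  by apply: continuous_compact (@segment_compact _ c d);
    exact: continuous_subspaceT.
exists M; split; rewrite ?num_real// => x xM y ycd; apply: (Mp _ xM).
by exists y.
Qed.

Lemma test_function_continuous a b p : test_function a b p -> continuous p.
Proof.
by case=> dp _ _ x; apply/differentiable_continuous/derivable1_diffP.
Qed.

Lemma integrable_mul_test a b u p : locally_integrable `]a, b[ u ->
  test_function a b p ->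
  mu.-integrable `]a, b[ (EFin \o (fun x => u x * p x)).
Proof.
move=> iu tp; have [c [d [ac db p0 _]]] := test_function_support tp.
exact: integrable_mul_compact_support (test_function_continuous tp) ac db p0.
Qed.

Lemma integrable_mul_test_derive a b u p : locally_integrable `]a, b[ u ->
  test_function a b p ->
  mu.-integrable `]a, b[ (EFin \o (fun x => u x * derive1 p x)).
Proof.
move=> iu tp; have [c [d [ac db _ p0]]] := test_function_support tp.
by case: tp => _ cp _; exact: integrable_mul_compact_support cp ac db p0.
Qed.

Lemma locally_integrableZ (D : set R) k u :
  locally_integrable D u -> locally_integrable D (fun x => k * u x).
Proof.
move=> [mu_ oD iu]; split => // [|K KD cK].
  by apply: measurable_funM => //; exact: measurable_cst.
have mK := compact_measurable cK.
have : mu.-integrable K (fun x => k%:E * (EFin \o u) x)%E.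
  apply: integrableZl => //; apply/integrableP; split; last exact: iu.
  by apply/measurable_EFinP; apply: measurable_funS mu_ => //;
    exact: open_measurable.
by case/integrableP.
Qed.

Lemma is_weak_derivD a b u v g h :
  is_weak_deriv a b u g -> is_weak_deriv a b v h ->
  is_weak_deriv a b (fun x => u x + v x) (fun x => g x + h x).
Proof.
move=> [iu ig ug] [iv ih vh]; split; [exact: locally_integrableD..|].
move=> p tp; under eq_Rintegral do rewrite mulrDl.
rewrite RintegralD// ?ug ?vh//; try exact: integrable_mul_test_derive tp.
under [in RHS]eq_Rintegral do rewrite mulrDl.
by rewrite RintegralD// ?opprD//; exact: integrable_mul_test tp.
Qed.

Lemma is_weak_derivZ a b k u g : is_weak_deriv a b u g ->
  is_weak_deriv a b (fun x => k * u x) (fun x => k * g x).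
Proof.
move=> [iu ig ug]; split; [exact: locally_integrableZ..|].
move=> p tp; under eq_Rintegral do rewrite -mulrA.
rewrite RintegralZl// ?ug//; last exact: integrable_mul_test_derive tp.
under [in RHS]eq_Rintegral do rewrite -mulrA.
by rewrite RintegralZl// ?mulrN//; exact: integrable_mul_test tp.
Qed.

Lemma weak_derivP a b u :
  weakly_derivable a b u -> is_weak_deriv a b u (weak_deriv a b u).
Proof. by case=> g ug; apply: (xgetPex (fun=> 0)); exists g. Qed.

(** Fundamental theorem of calculus on the closed interval: [a] and [b] lie outside the support of
    [p], so both boundary values are 0. *)
Lemma Rintegral_derive_test a b p : a < b -> test_function a b p ->
  \int[mu]_(x in `]a, b[) derive1 p x = 0.
Proof.
move=> ab tp; have [c [d [ac db p0 _]]] := test_function_support tp.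
have cp := test_function_continuous tp; case: tp => dp cdp _.
have cdp' : {within `[a, b], continuous (derive1 p)}.
  exact: continuous_subspaceT.
have ip : mu.-integrable `[a, b] (EFin \o derive1 p).
  by apply: continuous_compact_integrable => //; exact: segment_compact.
rewrite Rintegral_itv_bndo_bndc; last first.
  by apply: integrableS ip => //; exact: subset_itv_oo_cc.
rewrite Rintegral_itv_obnd_cbnd; last first.
  by apply: integrableS ip => //; exact: subset_itv_oc_cc.
rewrite /Rintegral (@continuous_FTC2 _ _ p)//.
- have -> : p a = 0 by apply: p0; rewrite in_itv/= negb_and -!ltNge ac.
  have -> : p b = 0 by apply: p0; rewrite in_itv/= negb_and -!ltNge db orbT.
  by rewrite sube0.
- split; first by move=> x _; exact: dp.
    exact/cvg_at_right_filter/cp.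
  exact/cvg_at_left_filter/cp.
Qed.

(** Both steps rise from 0 to the same height [2 * e ^+ 2]. Their difference therefore vanishes to
    the left of both windows and also to the right of both. *)
Lemma test_function_steps a b s t e : 0 < e ->
  a < s - e -> s + e < b -> a < t - e -> t + e < b ->
  test_function a b (smooth_step e s \- smooth_step e t).
Proof.
move=> e0 as_ sb at_ tb.
have d x : is_derive x 1 (smooth_step e s \- smooth_step e t)
    (2 * tent e s x - 2 * tent e t x).
  by apply: is_deriveB; exact: is_derive_smooth_step.
split => [x||].
- by case: (d x).
- have -> : derive1 (smooth_step e s \- smooth_step e t) =
      (fun x => 2 * tent e s x - 2 * tent e t x).
    by apply/funext => x; rewrite derive1E; case: (d x).
  by move=> x; apply: cvgB; (apply: cvgM; first exact: cvg_cst);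
    exact: continuous_tent.
- exists (Num.min (s - e) (t - e)), (Num.max (s + e) (t + e)).
  rewrite lt_min gt_max as_ at_ sb tb; split => // x.
  rewrite in_itv/= negb_and -!ltNge lt_min gt_max => /orP[] /andP[h1 h2].
    by rewrite !smooth_step_left ?subrr// ltW.
  by rewrite !smooth_step_right ?subrr// ltW.
Qed.

Lemma Rintegral_eq0_ae (D : set R) f : measurable D ->
  mu.-integrable D (EFin \o f) -> (forall x, D x -> 0 <= f x) ->
  \int[mu]_(x in D) f x = 0 -> {ae mu, forall x, D x -> f x = 0}.
Proof.
move=> mD /[dup] if_ /integrableP[mf foo] f0 If.
have : (\int[mu]_(x in D) `|(EFin \o f) x| = 0)%E.
  have -> : (\int[mu]_(x in D) `|(EFin \o f) x| = \int[mu]_(x in D) (f x)%:E)%E.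
    by apply: eq_integral => x; rewrite inE => xD; rewrite /= ger0_norm// f0.
  (* [Rintegral] is the [fine] part of the extended integral, and [fine] sends infinite values to 0.
     Integrability excludes that case. *)
  rewrite -[LHS]fineK; last exact: integrable_fin_num.
  by rewrite -[fine _]/(Rintegral mu D f) If.
move/(ae_eq_integral_abs mu mD mf); apply: filterS => x /= + Dx.
by move=> /(_ Dx) [].
Qed.

(* du Bois-Reymond: test against the difference of two narrow tents. *)
Lemma weak_deriv0_le a b u g : {in `]a, b[, continuous u} ->
  is_weak_deriv a b u g -> {ae mu, forall s, `]a, b[%classic s -> g s = 0} ->
  {in `]a, b[ &, forall s t, u t <= u s}.
Proof.
move=> cu [iu ig ug] g0 s t sab tab; rewrite leNgt; apply/negP => ust.
have /andP[as_ sb] : a < s < b by move: sab; rewrite in_itv.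
have /andP[at_ tb] : a < t < b by move: tab; rewrite in_itv.
have ab := lt_trans as_ sb.
(* Under the assumption [u s < u t], this level separates the two values: by continuity [u] stays
   below [m] near [s] and above [m] near [t]. The width [e] is then taken so small that both windows
   lie in these neighbourhoods and inside the interval. *)
pose m := (u s + u t) / 2.
have usm : u s < m by rewrite /m; lra.
have umt : m < u t by rewrite /m; lra.
have := cu _ sab; move=> /cvgr_lt /(_ _ usm) [r1 /= r10 hr1].
have := cu _ tab; move=> /cvgr_gt /(_ _ umt) [r2 /= r20 hr2].
have lt_near k : 0 < k -> \forall e \near (0 : R)^'+, e < k.
  by move=> k0; exact: nbhs_right_lt.
near (0 : R)^'+ => e.
have e0 : 0 < e by near: e; exact: nbhs_right_gt.
have e1 : e < s - a by near: e; apply: lt_near; lra.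
have e2 : e < b - s by near: e; apply: lt_near; lra.
have e3 : e < t - a by near: e; apply: lt_near; lra.
have e4 : e < b - t by near: e; apply: lt_near; lra.
have er1 : e < r1 by near: e; exact: lt_near.
have er2 : e < r2 by near: e; exact: lt_near.
have us x : `|x - s| < e -> u x < m.
  by move=> xe; apply: hr1; rewrite /= distrC (lt_trans xe).
have ut x : `|x - t| < e -> m < u x.
  by move=> xe; apply: hr2; rewrite /= distrC (lt_trans xe).
pose p := smooth_step e s \- smooth_step e t.
have tp : test_function a b p by apply: test_function_steps => //; lra.
have dpE x : derive1 p x = 2 * tent e s x - 2 * tent e t x.
  have [_ <-] : is_derive x 1 p (2 * tent e s x - 2 * tent e t x).
    by apply: is_deriveB; exact: is_derive_smooth_step.
  by rewrite derive1E.
have icst : locally_integrable `]a, b[ (fun=> m).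
  apply: open_integrable_locally; first exact: interval_open.
  apply: integrableS
    (continuous_compact_integrable (@segment_compact _ a b) _) => //.
    exact: subset_itv_oo_cc.
  by apply: continuous_subspaceT => x; exact: cst_continuous.
(* This is [(m - u) * p']. Its integral is zero, because [p'] has mean zero and the integral of
   [u * p'] is minus that of [g * p], where [g] is 0 almost everywhere. It is also nonnegative,
   because [m - u] is positive under the tent at [s] and negative under the tent at [t], which
   enters [p'] with a minus sign. *)
pose f x := m * derive1 p x - u x * derive1 p x.
have i1 := integrable_mul_test_derive icst tp.
have i2 := integrable_mul_test_derive iu tp.
have if_ : mu.-integrable `]a, b[ (EFin \o f) by exact: (integrableB _ i1 i2).
have If : \int[mu]_(x in `]a, b[) f x = 0.
  rewrite RintegralB// ug// RintegralZl//; last first.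
    apply: integrableS
    (continuous_compact_integrable (@segment_compact _ a b) _) => //.
      exact: subset_itv_oo_cc.
    by apply: continuous_subspaceT; case: tp.
  rewrite Rintegral_derive_test// mulr0 opprK add0r.
  rewrite /Rintegral (@ae_eq_integral _ _ _ _ _ (cst 0%E))//.
  - by rewrite integral0.
  - by have /integrableP[] := integrable_mul_test ig tp.
  - apply: (@filterS _ _ (ae_filter_ringOfSetsType mu)) g0 => x gx /gx.
    by rewrite /= => ->; rewrite mul0r.
have f_ge0 x : 0 <= f x.
  rewrite /f -mulrBl dpE -mulrBr mulrCA mulr_ge0// mulrBr subr_ge0.
  apply: (@le_trans _ _ 0).
    case: (ltP `|x - t| e) => [xt|/(tent_out e0)->]; last by rewrite mulr0.
    by rewrite nmulr_rle0 ?tent_ge0// subr_lt0 ut.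
  case: (ltP `|x - s| e) => [xs|/(tent_out e0)->]; last by rewrite mulr0.
  by rewrite mulr_ge0 ?tent_ge0// subr_ge0 ltW// us.
have f_gt0 x : `|x - s| < e -> 0 < f x.
  move=> xs; rewrite /f -mulrBl dpE -mulrBr mulrCA mulr_gt0// mulrBr subr_gt0.
  apply: (@le_lt_trans _ _ 0).
    case: (ltP `|x - t| e) => [xt|/(tent_out e0)->]; last by rewrite mulr0.
    by rewrite nmulr_rle0 ?tent_ge0// subr_lt0 ut.
  by rewrite mulr_gt0 ?tent_gt0// subr_gt0 us.
(* A nonnegative function of zero integral vanishes almost everywhere, yet [f] is positive on a
   window of length [2 * e] around [s]. *)
have [//|N [mN N0 fN]] := Rintegral_eq0_ae _ if_ (fun x _ => f_ge0 x) If.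
have : (mu `](s - e)%R, (s + e)%R[%classic <= mu N)%E.
  apply: le_measure; rewrite ?inE//.
  move=> x /=; rewrite in_itv/= => /andP[x1 x2]; apply: fN => /=.
  have xs : `|x - s| < e by rewrite ltr_norml; apply/andP; split; lra.
  apply/not_implyP; split; first by rewrite in_itv/=; apply/andP; split; lra.
  by apply/eqP; rewrite gt_eqF// f_gt0.
rewrite N0 lebesgue_measure_itv/= lte_fin ifT; last by lra.
by rewrite -EFinB lee_fin; lra.
Unshelve. all: by end_near. Qed.

(** The inequality of [weak_deriv0_le], used in both orders, makes [u] constant on the open
    interval. Uniqueness of one-sided limits carries the constant to the end points. *)
Lemma weak_deriv0_constant a b u g : a < b ->
  {within `[a, b], continuous u} -> is_weak_deriv a b u g ->
  {ae mu, forall s, `]a, b[%classic s -> g s = 0} ->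
  {in `[a, b] &, forall s t, u s = u t}.
Proof.
move=> ab /(continuous_within_itvP _ ab)[cu cua cub] ug g0.
pose z := (a + b) / 2.
have zab : z \in `]a, b[ by rewrite in_itv/= /z; apply/andP; split; lra.
have inner s : s \in `]a, b[ -> u s = u z.
  by move=> sab; apply/le_anti; rewrite !(weak_deriv0_le cu ug g0).
have ua : u a = u z.
  apply: (cvg_unique _ cua); first exact: norm_hausdorff.
  apply: cvg_near_cst; near=> x; apply: inner.
  by rewrite in_itv/=; apply/andP; split; near: x;
    [exact: nbhs_right_gt|exact: nbhs_right_lt].
have ub : u b = u z.
  apply: (cvg_unique _ cub); first exact: norm_hausdorff.
  apply: cvg_near_cst; near=> x; apply: inner.
  by rewrite in_itv/=; apply/andP; split; near: x;
    [exact: nbhs_left_gt|exact: nbhs_left_lt].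
suff h s : s \in `[a, b] -> u s = u z by move=> s t /h-> /h->.
rewrite in_itv/= !le_eqVlt => /andP[/predU1P[<-//|as_] /predU1P[->//|sb]].
by apply: inner; rewrite in_itv/= as_ sb.
Unshelve. all: by end_near. Qed.

(** The product is dominated by the integrable function [f ^+ 2 + g ^+ 2]. *)
Lemma L2_integrableM a b f g : L2 a b f -> L2 a b g ->
  mu.-integrable `]a, b[ (EFin \o (fun x => f x * g x)).
Proof.
move=> [mf if_] [mg ig].
apply: le_integrable (integrableD _ if_ ig) => //.
  by apply/measurable_EFinP; exact: measurable_funM.
move=> x _; rewrite /= lee_fin [leRHS]ger0_norm ?addr_ge0 ?sqr_ge0//.
by rewrite ler_norml; apply/andP; split; nra.
Qed.

Lemma L2D a b f g : L2 a b f -> L2 a b g -> L2 a b (fun x => f x + g x).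
Proof.
move=> lf lg; split; first by apply: measurable_funD; [case: lf|case: lg].
have -> : (fun x => ((f x + g x) ^+ 2)%:E) = ((fun x => (f x ^+ 2)%:E) \+
    ((EFin \o (fun x => f x * g x)%R) \+ (EFin \o (fun x => f x * g x)%R)) \+
    (fun x => (g x ^+ 2)%:E))%E.
  by apply/funext => x; rewrite /= -!EFinD; congr EFin; ring.
have ifg := L2_integrableM lf lg.
apply: integrableD => //; last by case: lg.
apply: integrableD => //; first by case: lf.
exact: integrableD.
Qed.

Lemma L2Z a b k f : L2 a b f -> L2 a b (fun x => k * f x).
Proof.
move=> [mf if_]; split.
  by apply: measurable_funM => //; exact: measurable_cst.
have -> : (fun x => ((k * f x) ^+ 2)%:E) =
    (fun x => (k ^+ 2)%:E * (f x ^+ 2)%:E)%E.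
  by apply/funext => x; rewrite exprMn EFinM.
exact: integrableZl.
Qed.

Lemma eq_L2 a b f g : {in `]a, b[, f =1 g} -> L2 a b f -> L2 a b g.
Proof.
move=> fg [mf if_]; split.
  by apply: eq_measurable_fun mf => x; rewrite inE => /fg.
by apply: eq_integrable if_ => // x; rewrite inE => /fg /= ->.
Qed.

(** The interval has finite measure, so the constant 1 is an integrable bound for the square. *)
Lemma L2_ae_le1 a b f : measurable_fun `]a, b[ f ->
  {ae mu, forall s, `]a, b[%classic s -> f s ^+ 2 <= 1} -> L2 a b f.
Proof.
move=> mf f1; split => //; apply/integrableP.
have mf2 : measurable_fun `]a, b[ (fun s => (f s ^+ 2)%:E).
  by apply/measurable_EFinP; exact: measurable_funX.
split => //; apply: (@le_lt_trans _ _ (\int[mu]_(x in `]a, b[) 1)%E).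
  apply: ae_ge0_le_integral => //.
    exact: measurableT_comp.
  apply: (@filterS _ _ (ae_filter_ringOfSetsType mu)) f1 => x fx /fx.
  by rewrite /= ger0_norm ?sqr_ge0// lee_fin.
rewrite integral_cst// mul1e /= lebesgue_measure_itv/=.
by case: ifPn => _; rewrite ?ltry// -EFinB ltry.
Qed.

End IntervalCalculus.

(** * Gram matrices of square integrable functions *)

Section QuadraticForms.
Variable R : realType.
Implicit Types a b : R.
Local Notation mu := (@lebesgue_measure R).

Lemma integrable_sumR (I : Type) (r : seq I) (D : set (measurableTypeR R))
    (F : I -> R -> R) :
  measurable D -> (forall i, mu.-integrable D (EFin \o F i)) ->
  mu.-integrable D (EFin \o (fun x => \sum_(i <- r) F i x)).
Proof.
move=> mD iF; have := integrable_sum mD r (P := xpredT) (fun i _ => iF i).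
by apply: eq_integrable => // x _; rewrite /= sumEFin.
Qed.

Lemma Rintegral_sum (I : Type) (r : seq I) (D : set (measurableTypeR R))
    (F : I -> R -> R) :
  measurable D -> (forall i, mu.-integrable D (EFin \o F i)) ->
  \int[mu]_(x in D) (\sum_(i <- r) F i x) =
  \sum_(i <- r) \int[mu]_(x in D) F i x.
Proof.
move=> mD iF; elim: r => [|i r IH].
  under eq_Rintegral do rewrite big_nil.
  by rewrite big_nil Rintegral_cst// mul0r.
under eq_Rintegral do rewrite big_cons.
by rewrite big_cons -IH RintegralD//; exact: integrable_sumR.
Qed.

Lemma L2_sum a b (I : Type) (r : seq I) (F : I -> R -> R) :
  (forall i, L2 a b (F i)) -> L2 a b (fun x => \sum_(i <- r) F i x).
Proof.
move=> lF; elim: r => [|i r IH].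
  have -> : (fun x => \sum_(i <- [::]) F i x) = cst 0.
    by apply/funext => x; rewrite big_nil.
  split; first exact: measurable_cst.
  by rewrite /= expr0n; exact: integrable0.
have -> : (fun x => \sum_(j <- i :: r) F j x) =
    (fun x => F i x + \sum_(j <- r) F j x).
  by apply/funext => x; rewrite big_cons.
exact: L2D.
Qed.

Lemma Rintegral_sqr_sum a b (I : finType) (c : I -> R) (F : I -> R -> R) :
  (forall i, L2 a b (F i)) ->
  \int[mu]_(x in `]a, b[) ((\sum_i c i * F i x) ^+ 2) =
  \sum_i \sum_j c i * c j * \int[mu]_(x in `]a, b[) (F i x * F j x).
Proof.
move=> lF.
have iF i j := L2_integrableM (lF i) (lF j).
have icF i j :
    mu.-integrable `]a, b[ (EFin \o (fun x => c i * c j * (F i x * F j x))).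
  have -> : EFin \o (fun x => c i * c j * (F i x * F j x)) =
      (fun x => (c i * c j)%:E * (EFin \o (fun x => F i x * F j x)%R) x)%E.
    by apply/funext => x; rewrite /= EFinM.
  by apply: integrableZl => //; exact: iF.
transitivity (\int[mu]_(x in `]a, b[)
    (\sum_i \sum_j c i * c j * (F i x * F j x))).
  apply: eq_Rintegral => x _; rewrite expr2 big_distrlr/=.
  by do 2 (apply: eq_bigr => ? _); rewrite mulrACA.
rewrite Rintegral_sum//; last by move=> i; exact: integrable_sumR.
apply: eq_bigr => i _; rewrite Rintegral_sum//.
by apply: eq_bigr => j _; rewrite RintegralZl.
Qed.

End QuadraticForms.

(** * Graphs *)

Section GraphCalculus.
Variables (R : realType) (G : planar_graph R).
Implicit Types (e : edge G) (v w : vertex G) (u : 'cV[R]_2 -> R).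
Local Notation mu := (@lebesgue_measure R).

(** The choice made by [xget] is harmless: disjointness of the open edges determines the edge
    through the point, and injectivity of its curve determines the parameter. *)
Lemma on_edgesE (T : zmodType) (F : edge G -> R -> T) e s :
  graph_wf G -> edge_dom e s -> on_edges F (curve e s) = F e s.
Proof.
move=> wf es; rewrite /on_edges.
set Z := [set z | _].
have [e' [s' [es' cs <-]]] : Z (xget 0 Z).
  by apply: xgetPex; exists (F e s), e, s.
have ee : e' = e.
  apply: (edges_disjoint wf) => //; exists (curve e s); split.
    by exists s'.
  by exists s.
move: es' cs; rewrite ee => es' cs.
by rewrite (curve_inj (graph_edges wf e) _ _ cs).
Qed.

Lemma curve_Gamma e s :
  graph_wf G -> s \in `[lo e, hi e] -> Gamma G (curve e s).
Proof.
move=> wf; rewrite in_itv/= !le_eqVlt.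
move=> /andP[/predU1P[<-|ls] /predU1P[->|sh]].
- by rewrite (curve_tgt (graph_edges wf e)); left; exists (tgt e).
- by rewrite (curve_src (graph_edges wf e)); left; exists (src e).
- by rewrite (curve_tgt (graph_edges wf e)); left; exists (tgt e).
- by right; exists e => //; exists s; rewrite // /edge_dom /= in_itv/= ls sh.
Qed.

Lemma within_continuous_curve u e : graph_wf G ->
  {within Gamma G, continuous u} ->
  {within `[lo e, hi e], continuous (u \o curve e)}.
Proof.
move=> wf /subspace_continuousP cu; apply/subspace_continuousP => s es.
have cc : curve e @ within `[lo e, hi e] (nbhs s) --> curve e s.
  move: s es; apply/subspace_continuousP.
  exact: curve_continuous (graph_edges wf e).
have Gs := curve_Gamma wf es.
move=> W /= /(cu _ Gs) /= /cc /=; rewrite /within /nbhs/= => H.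
apply: filterS H => t /= Ht et.
by apply: (Ht et); exact: curve_Gamma.
Qed.

(** The square of one component is at most the squared speed, which is 1 almost everywhere. *)
Lemma velocity_L2 e i : graph_wf G ->
  L2 (lo e) (hi e) (fun s => velocity e s i 0).
Proof.
move=> wf; have we := graph_edges wf e; apply: L2_ae_le1.
  have -> : (fun s => velocity e s i 0) =
      weak_deriv (lo e) (hi e) (fun r => curve e r i 0).
    by apply/funext => s; rewrite mxE.
  by have [_ []] := weak_derivP (curve_derivable we i).
have := curve_unit_speed we.
apply: (@filterS _ _ (ae_filter_ringOfSetsType mu)) => s + es => /(_ es) <-.
by rewrite (bigD1 i)//= lerDl sumr_ge0// => j _; exact: sqr_ge0.
Qed.

Lemma dGamma_L2 u e : graph_wf G -> H1_graph G u ->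
  L2 (lo e) (hi e) (weak_deriv (lo e) (hi e) (u \o curve e)).
Proof.
move=> wf [_ _ /(_ e) + _]; apply: eq_L2 => s es.
by rewrite /= /dGamma on_edgesE.
Qed.

(** The edge [e0] contributes the positive length [hi e0 - lo e0]; on a graph without edges the
    length would be an empty sum. *)
Lemma total_length_gt0 e0 : graph_wf G -> 0 < total_length G.
Proof.
move=> wf; have len e : \int[mu]_(s in edge_dom e) 1 = hi e - lo e.
  rewrite Rintegral_cst ?mul1r /edge_dom; last exact: measurable_itv.
  by rewrite /= lebesgue_measure_itv/= lte_fin (lo_lt_hi (graph_edges wf e)).
rewrite /total_length /intGamma (bigD1 e0)//= len.
apply: ltr_pwDl; first by rewrite subr_gt0 (lo_lt_hi (graph_edges wf e0)).
by apply: sumr_ge0 => e _; rewrite len subr_ge0 ltW//;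
  exact: lo_lt_hi (graph_edges wf e).
Qed.

(** Induction along a path joining the two vertices. [edge_rel] ignores orientation, so each step
    may follow an edge in either direction. *)
Lemma constant_of_edges (T : Type) (f : vertex G -> T) : graph_wf G ->
  (forall e, f (src e) = f (tgt e)) -> forall v w, f v = f w.
Proof.
move=> wf fe v w; have /connectP[p] := graph_connected wf v w.
elim: p v => [|z p IH] v /=; first by move=> _ ->.
move=> /andP[/existsP[e /orP[]/andP[/eqP<- /eqP<-]] pz] wz;
  by rewrite -(IH _ pz wz) fe.
Qed.

End GraphCalculus.

(** * Strain, potential and energy of the corrected coordinates *)

Section CellProblem.
Variables (R : realType) (G : planar_graph R) (phi : 'cV[R]_2 -> 'cV[R]_2).
Implicit Types (e : edge G) (x : 'cV[R]_2).
Local Notation mu := (@lebesgue_measure R).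

(** The components of [t + d phi], read in the arc length parameter of the edge. *)
Definition edge_strain e (i : 'I_2) (s : R) : R := velocity e s i 0 +
  weak_deriv (lo e) (hi e) ((fun y => phi y i 0) \o curve e) s.

Definition potential x (y : 'cV[R]_2) : R :=
  \sum_i x i 0 * (y i 0 + phi y i 0).

Definition energy x e : R :=
  \int[mu]_(s in edge_dom e) ((\sum_i x i 0 * edge_strain e i s) ^+ 2).

Hypothesis wf : graph_wf G.
Hypothesis phiH1 : forall i, H1_graph G (fun y => phi y i 0).

Lemma edge_strain_L2 e i : L2 (lo e) (hi e) (edge_strain e i).
Proof. by apply: L2D; [exact: velocity_L2|exact: dGamma_L2]. Qed.

Lemma energy_ge0 x e : 0 <= energy x e.
Proof. by apply: Rintegral_ge0 => s _; exact: sqr_ge0. Qed.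

(** The integrals only see open edges, where [on_edgesE] evaluates the tangent and the derivatives.
    The result is a scaled Gram matrix of the strain components. *)
Lemma A_homE i j : A_hom G phi i j = (total_length G)^-1 *
  \sum_e \int[mu]_(s in edge_dom e) (edge_strain e i s * edge_strain e j s).
Proof.
rewrite !mxE; congr (_ * _); apply: eq_bigr => e _.
apply: eq_Rintegral => s; rewrite inE => es.
by rewrite !mxE big_ord1 !mxE /tangent /dGamma !on_edgesE//.
Qed.

Lemma A_hom_sym i j : A_hom G phi i j = A_hom G phi j i.
Proof.
have swap e : \int[mu]_(s in edge_dom e) (edge_strain e i s * edge_strain e j s)
    = \int[mu]_(s in edge_dom e) (edge_strain e j s * edge_strain e i s).
  by apply: eq_Rintegral => s _; exact: mulrC.
by rewrite !A_homE (eq_bigr _ (fun e _ => swap e)).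
Qed.

(** The quadratic form of a Gram matrix is the integral of the squared linear combination. What
    remains is to exchange the sums over edges and over the two indices. *)
Lemma A_hom_quadratic x : (x^T *m A_hom G phi *m x) 0 0 =
  (total_length G)^-1 * \sum_e energy x e.
Proof.
rewrite mxE.
under eq_bigr => j _.
  rewrite mxE big_distrl/=.
  under eq_bigr => i _ do rewrite mxE A_homE mulrAC mulrCA big_distrr/=.
  rewrite -big_distrr/=; over.
rewrite -big_distrr/=; congr (_ * _).
have energyE e : energy x e = \sum_i \sum_j x i 0 * x j 0 *
    \int[mu]_(s in edge_dom e) (edge_strain e i s * edge_strain e j s).
  by apply: Rintegral_sqr_sum => i; exact: edge_strain_L2.
rewrite (eq_bigr _ (fun e _ => energyE e)).
rewrite [RHS]exchange_big [LHS]exchange_big/=; apply: eq_bigr => i _.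
by rewrite [RHS]exchange_big/=.
Qed.

Lemma potential_continuous x e :
  {within `[lo e, hi e], continuous (potential x \o curve e)}.
Proof.
apply: within_continuous_curve => //; apply/subspace_continuousP => y Gy.
apply: cvg_big => [|i _]; first exact: add_continuous.
apply: cvgM; first exact: cvg_cst.
apply: cvgD.
  by apply: cvg_within_filter; exact: coord_continuous.
have [_ _ _ /subspace_continuousP cphi] := phiH1 i.
exact: cphi.
Qed.

Lemma potential_weak_deriv x e :
  is_weak_deriv (lo e) (hi e) (potential x \o curve e)
    (fun s => \sum_i x i 0 * edge_strain e i s).
Proof.
have part i : is_weak_deriv (lo e) (hi e)
    (fun s => x i 0 * (curve e s i 0 + phi (curve e s) i 0))
    (fun s => x i 0 * edge_strain e i s).
  apply: is_weak_derivZ; apply: is_weak_derivD.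
    have -> : (fun s => velocity e s i 0) =
        weak_deriv (lo e) (hi e) (fun r => curve e r i 0).
      by apply/funext => s; rewrite mxE.
    exact/weak_derivP/curve_derivable/graph_edges.
  by apply: weak_derivP; have [_ + _ _] := phiH1 i; exact.
(* The sum over ['I_2] is written out as two terms, so that additivity of weak derivatives applies
   once. *)
have -> : potential x \o curve e = (fun s =>
    x ord0 0 * (curve e s ord0 0 + phi (curve e s) ord0 0) +
    x (lift ord0 ord0) 0 *
      (curve e s (lift ord0 ord0) 0 + phi (curve e s) (lift ord0 ord0) 0)).
  by apply/funext => s; rewrite /potential /= big_ord_recl big_ord1.
have -> : (fun s => \sum_i x i 0 * edge_strain e i s) = (fun s =>
    x ord0 0 * edge_strain e ord0 s +
    x (lift ord0 ord0) 0 * edge_strain e (lift ord0 ord0) s).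
  by apply/funext => s; rewrite big_ord_recl big_ord1.
exact: is_weak_derivD.
Qed.

Lemma potential_edge x e : energy x e = 0 ->
  potential x (pos (src e)) = potential x (pos (tgt e)).
Proof.
move=> E0; have we := graph_edges wf e.
rewrite -(curve_src we) -(curve_tgt we).
have le_lh := ltW (lo_lt_hi we).
have lc : L2 (lo e) (hi e) (fun s => \sum_i x i 0 * edge_strain e i s).
  by apply: L2_sum => i; apply: L2Z; exact: edge_strain_L2.
have strain0 : {ae mu, forall s, `]lo e, hi e[%classic s ->
    \sum_i x i 0 * edge_strain e i s = 0}.
  have : {ae mu, forall s, `]lo e, hi e[%classic s ->
      (\sum_i x i 0 * edge_strain e i s) ^+ 2 = 0}.
    by apply: Rintegral_eq0_ae lc.2 _ E0 => // s _; exact: sqr_ge0.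
  apply: (@filterS _ _ (ae_filter_ringOfSetsType mu)) => s + es => /(_ es)/eqP.
  by rewrite sqrf_eq0 => /eqP.
have := weak_deriv0_constant (lo_lt_hi we) (@potential_continuous x e)
  (@potential_weak_deriv x e) strain0.
by apply; rewrite in_itv/= lexx le_lh.
Qed.

End CellProblem.

(** * Symmetry and positive definiteness on a unit mesh *)

Theorem lemma3p8 (R : realType) (G : planar_graph R)
  (phi : 'cV[R]_2 -> 'cV[R]_2) :
  unit_mesh G -> cell_solution G phi ->
  symmetric_mx (A_hom G phi) /\ posdef_mx (A_hom G phi).
Proof.
move=> mesh [phiper _]; have wf := mesh_graph mesh.
have phiH1 i : H1_graph G (fun y => phi y i 0) by case: (phiper i).
split.
  by apply/matrixP => i j; rewrite [LHS]mxE A_hom_sym.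
move=> x x0.
(* Opposite points of a mesh are vertices, so each crossing joins two vertices and constancy of the
   potential on vertices is enough. *)
have cross i : exists v w : vertex G, pos w = pos v + unit_vec R i.
  have [y [Gy Gyi]] := mesh_crossing mesh i.
  have yyi : opposite G y (y + unit_vec R i) by split => //; exists i.
  have [[v _ vy] [w _ wy]] := mesh_opposite mesh yyi.
  by exists v, w; rewrite vy wy.
(* Without edges, [constant_of_edges] applied to [pos] would put all vertices at one point, whereas
   a crossing separates two of them by a unit vector. *)
have [e0] : exists e0 : edge G, True.
  apply: contrapT => noedge; have [v [w vw]] := cross 0.
  have same (e : edge G) : pos (src e) = pos (tgt e) :> 'cV[R]_2.
    by case: noedge; exists e.
  have /eqP := constant_of_edges (f := @pos R G) wf same v w.
  rewrite vw -subr_eq0 opprD addNKr oppr_eq0 => /eqP/matrixP/(_ 0 0)/eqP.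
  by rewrite !mxE !eqxx/= oner_eq0.
move=> _; rewrite A_hom_quadratic// mulr_gt0 ?invr_gt0 ?total_length_gt0//.
rewrite lt0r sumr_ge0 ?andbT => [|e _]; last exact: energy_ge0.
apply: contra x0; rewrite psumr_eq0 => [/allP E0|e _]; last exact: energy_ge0.
have edge_const (e : edge G) :
    potential phi x (pos (src e)) = potential phi x (pos (tgt e)).
  apply: potential_edge => //.
  by have /implyP/(_ isT)/eqP := E0 e (mem_index_enum e).
have const := constant_of_edges (f := fun v => potential phi x (pos v)) wf
  edge_const.
apply/eqP/matrixP => i j; rewrite ord1 mxE.
have [v [w vw]] := cross i.
have per k : phi (pos w) k 0 = phi (pos v) k 0.
  apply/esym; apply: (phiper k).2; left.
  by split; [left; exists v|left; exists w|exists i].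
(* Periodicity cancels [phi] in both components, and the positions differ only in component [i], by
   1. *)
have : potential phi x (pos w) - potential phi x (pos v) = x i 0.
  rewrite /potential -sumrB (bigD1 i)//= big1 => [|k ki]; rewrite per vw !mxE.
    by rewrite eqxx/=; ring.
  by rewrite (negPf ki)/=; ring.
by rewrite (const w v) subrr => <-.
Qed.
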